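(* The complete first-order theory of the structure $\mathbb{D}=([0,1[,+_1,-_1,0,<)$ in the language $L=\{+,-,0,<\}$ admits quantifier elimination.
   Context: $+_1$ is addition modulo $1$ on $[0,1[$, $-_1$ the corresponding negation (so $-_1x=1-x$ for $x\neq0$ and $-_10=0$), and $<$ the order induced from $\mathbb{R}$; the symbols $+,-,0,<$ are interpreted by $+_1,-_1,0,<$. *)

(* Defs.v *)
From HB Require Import structures.
From mathcomp Require Import all_boot all_order all_algebra.
From mathcomp Require Import reals.
From mathcomp Require Import lra.

Set Implicit Arguments.
Unset Strict Implicit.
Unset Printing Implicit Defensive.

Import Order.TTheory GRing.Theory Num.Theory.
Local Open Scope ring_scope.

(** First-order logic with equality in the language L = {+, -, 0, <}, where
    "-" is unary. [term n] and [formula n] have their free variables among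
    n variables, indexed by 'I_n. *)

Inductive term (n : nat) : Type :=
| TVar of 'I_n
| TZero
| TOpp of term n
| TAdd of term n & term n.

Arguments TZero {n}.

(** Under a quantifier the bound variable has index [ord0], and the variable
    of index [i] outside has index [lift ord0 i] inside. *)
Inductive formula : nat -> Type :=
| FEq n of term n & term n : formula n
| FLt n of term n & term n : formula n
| FNot n of formula n : formula n
| FAnd n of formula n & formula n : formula n
| FOr n of formula n & formula n : formula n
| FImp n of formula n & formula n : formula n
| FForall n of formula n.+1 : formula n
| FExists n of formula n.+1 : formula n.

Definition FIff n (phi psi : formula n) : formula n :=
  FAnd (FImp phi psi) (FImp psi phi).

Fixpoint quantifier_free n (phi : formula n) : Prop :=
  match phi with
  | FEq _ _ _ | FLt _ _ _ => True
  | FNot _ p => quantifier_free p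
  | FAnd _ p q | FOr _ p q | FImp _ p q =>
      quantifier_free p /\ quantifier_free q
  | FForall _ _ | FExists _ _ => False
  end.

Definition sentence : Type := formula 0.

Fixpoint universal_closure n : formula n -> sentence :=
  match n with
  | 0 => fun phi => phi
  | m.+1 => fun phi => universal_closure (FForall phi)
  end.

Record L_structure := LStructure {
  carrier :> Type;
  s_zero : carrier;
  s_opp : carrier -> carrier;
  s_add : carrier -> carrier -> carrier;
  s_lt : carrier -> carrier -> Prop
}.

Section Semantics.
Variable M : L_structure.

Definition extend n (a : M) (v : 'I_n -> M) (i : 'I_n.+1) : M :=
  if unlift ord0 i is Some j then v j else a.

Fixpoint eval n (v : 'I_n -> M) (t : term n) : M :=
  match t with
  | TVar i => v i
  | TZero => s_zero M
  | TOpp t1 => s_opp (eval v t1)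
  | TAdd t1 t2 => s_add (eval v t1) (eval v t2)
  end.

Fixpoint satisfies n (phi : formula n) : ('I_n -> M) -> Prop :=
  match phi in formula n return ('I_n -> M) -> Prop with
  | FEq _ t1 t2 => fun v => eval v t1 = eval v t2
  | FLt _ t1 t2 => fun v => s_lt (eval v t1) (eval v t2)
  | FNot _ p => fun v => ~ satisfies p v
  | FAnd _ p q => fun v => satisfies p v /\ satisfies q v
  | FOr _ p q => fun v => satisfies p v \/ satisfies q v
  | FImp _ p q => fun v => satisfies p v -> satisfies q v
  | FForall _ p => fun v => forall a : M, satisfies p (extend a v)
  | FExists _ p => fun v => exists a : M, satisfies p (extend a v)
  end.

Definition holds (s : sentence) : Prop := forall v : 'I_0 -> M, satisfies s v.

End Semantics.

Definition theory : Type := sentence -> Prop.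

Definition complete_theory (M : L_structure) : theory := fun s => holds M s.

Definition is_model (M : L_structure) (T : theory) : Prop :=
  forall s, T s -> holds M s.

Definition entails (T : theory) (s : sentence) : Prop :=
  forall M : L_structure, is_model M T -> holds M s.

(** The case n = 0 is included: since L has a constant symbol, there are
    quantifier-free sentences. *)
Definition admits_QE (T : theory) : Prop :=
  forall (n : nat) (phi : formula n),
    exists psi : formula n,
      quantifier_free psi /\ entails T (universal_closure (FIff phi psi)).

Section StructureD.
Variable R : realType.

Definition Dcarrier : Type := {x : R | 0 <= x < 1}.

Lemma Dzero_subproof : 0 <= (0 : R) < 1.
Proof. by rewrite lexx ltr01. Qed.

Definition Dzero : Dcarrier := exist _ 0 Dzero_subproof.

Definition opp1 (x : R) : R := if x == 0 then 0 else 1 - x.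

Lemma Dopp_subproof (x : Dcarrier) : 0 <= opp1 (sval x) < 1.
Proof.
case: x => x /= /andP[x0 x1]; rewrite /opp1; case: eqVneq => [_|xN0].
  by rewrite lexx ltr01.
have {}x0 : 0 < x by rewrite lt_def xN0.
by apply/andP; split; lra.
Qed.

Definition Dopp (x : Dcarrier) : Dcarrier :=
  exist _ (opp1 (sval x)) (Dopp_subproof x).

Definition add1 (x y : R) : R := if x + y < 1 then x + y else x + y - 1.

Lemma Dadd_subproof (x y : Dcarrier) : 0 <= add1 (sval x) (sval y) < 1.
Proof.
case: x y => [x /= /andP[x0 x1]] [y /= /andP[y0 y1]]; rewrite /add1.
by case: ltP => xy; apply/andP; split; lra.
Qed.

Definition Dadd (x y : Dcarrier) : Dcarrier :=
  exist _ (add1 (sval x) (sval y)) (Dadd_subproof x y).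

Definition Dlt (x y : Dcarrier) : Prop := sval x < sval y.

Definition D : L_structure := LStructure Dzero Dopp Dadd Dlt.

End StructureD.

(* Main.v *)
(** On the unit cube, first-order formulas over D define exactly the finite
    Boolean combinations of affine inequalities with integer coefficients.
    A term takes the fractional part of an affine form, whose integer part has
    finitely many values on the cube; cutting the cube along these values makes
    atomic formulas semilinear, and Fourier-Motzkin elimination handles the
    quantifiers.  Conversely, the integer part of an affine form can be traced
    by quantifier-free formulas, one variable at a time: in an addition modulo 1
    of [x] a carry occurs iff the result is smaller than [x]. *)
Require Import Defs.
From HB Require Import structures.
From mathcomp Require Import all_boot all_order all_algebra.
From mathcomp Require Import boolp classical_sets reals.
From mathcomp Require Import lra.

Set Implicit Arguments.
Unset Strict Implicit.
Unset Printing Implicit Defensive.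

Import Order.TTheory GRing.Theory Num.Theory.
Local Open Scope classical_set_scope.
Local Open Scope ring_scope.

Section AffineForms.
Variable n : nat.

Definition affine : zmodType := ({ffun 'I_n -> int} * int)%type.

Definition aff_const (c : int) : affine := (0, c).
Definition aff_var (i : 'I_n) : affine := ([ffun j => (j == i)%:R], 0).

Definition aff_eval (R : pzRingType) (x : 'I_n -> R) (f : affine) : R :=
  \sum_i x i *~ f.1 i + f.2%:~R.

Lemma aff_eval_is_zmod_morphism (R : pzRingType) (x : 'I_n -> R) :
  zmod_morphism (aff_eval x).
Proof.
move=> f g; rewrite /aff_eval /= mulrzBr opprD addrACA -sumrB.
by congr (_ + _); apply: eq_bigr => i _; rewrite !ffunE mulrzBr.
Qed.

HB.instance Definition _ (R : pzRingType) (x : 'I_n -> R) :=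
  GRing.isZmodMorphism.Build affine R (aff_eval x)
    (aff_eval_is_zmod_morphism x).

Lemma aff_eval_const (R : pzRingType) (x : 'I_n -> R) c :
  aff_eval x (aff_const c) = c%:~R.
Proof. by rewrite /aff_eval big1 ?add0r // => i _; rewrite ffunE mulr0z. Qed.

Lemma aff_eval_var (R : pzRingType) (x : 'I_n -> R) i :
  aff_eval x (aff_var i) = x i.
Proof.
rewrite /aff_eval (bigD1 i) //= big1 ?ffunE ?eqxx ?addr0 ?mulr1z // => j ji.
by rewrite ffunE (negPf ji) mulr0z.
Qed.

Lemma aff_evalDvar (R : pzRingType) (x : 'I_n -> R) f i :
  aff_eval x (f + aff_var i) = aff_eval x f + x i.
Proof. by rewrite raddfD /= aff_eval_var. Qed.

Lemma affine_sum_var (f : affine) :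
  f = aff_const f.2 + \sum_i aff_var i *~ f.1 i.
Proof.
case: f => a c; apply/eqP; rewrite -pair_eqE /pair_eq /= !raddf_sum /=.
apply/andP; split; last first.
  by rewrite big1 ?addr0 // => i _; rewrite raddfMz mul0rz.
apply/eqP/ffunP => j; rewrite add0r sum_ffunE (bigD1 j) //= big1 ?addr0.
  by rewrite raddfMz /= ffunMzE ffunE eqxx /= intz.
by move=> i ij; rewrite raddfMz /= ffunMzE ffunE eq_sym (negPf ij) mul0rz.
Qed.

Lemma affine_ind (P : affine -> Prop) :
  (forall c, P (aff_const c)) -> (forall f i, P f -> P (f + aff_var i)) ->
  (forall f, P f -> P (- f)) -> forall f, P f.
Proof.
move=> Pconst Padd Popp f.
have Psub g i : P g -> P (g - aff_var i).
  by move=> /Popp/(Padd _ i)/Popp; rewrite opprD opprK.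
have Paddz g i (k : int) : P g -> P (g + aff_var i *~ k).
  move=> Pg; elim/int_ind: k => [|k|k]; first by rewrite mulr0z addr0.
    by rewrite intS [1 + _]addrC mulrzDr mulr1z addrA; apply: Padd.
  by rewrite intS [1 + _]addrC opprD mulrzDr mulrN1z addrA; apply: Psub.
rewrite [f]affine_sum_var; elim: index_enum => [|i r IHr].
  by rewrite big_nil addr0.
by rewrite big_cons addrCA addrC; apply: Paddz.
Qed.

End AffineForms.

Section FirstCoordinate.
Variable n : nat.
Implicit Type f : affine n.+1.

Definition cons_point (T : Type) (y : T) (x : 'I_n -> T) (i : 'I_n.+1) : T :=
  if unlift ord0 i is Some j then x j else y.

Definition aff_slope f : int := f.1 ord0.
Definition aff_tail f : affine n := ([ffun i => f.1 (lift ord0 i)], f.2).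

Lemma aff_eval_cons (R : pzRingType) (y : R) (x : 'I_n -> R) f :
  aff_eval (cons_point y x) f = y * (aff_slope f)%:~R + aff_eval x (aff_tail f).
Proof.
rewrite /aff_eval big_ord_recl /cons_point unlift_none mulrzr -addrA.
by congr (_ + (_ + _)); apply: eq_bigr => i _; rewrite liftK ffunE.
Qed.

End FirstCoordinate.

Section IntervalBounds.
Variable R : realFieldType.
Local Open Scope order_scope.

(* [BLeft y] is the cut just below [y]: the point [y] lies in [Interval l u] iff
   [l <= BLeft y < u]. *)
Lemma ex_point_between (ls us : seq (itv_bound R)) :
  +oo \notin ls -> -oo \notin us ->
  (exists y : R, all (<= BLeft y) ls && all (> BLeft y) us) <->
  allrel <%O ls us.
Proof.
move=> ls_lty us_gtNy.
split=> [[y /andP[/allP lsy /allP usy]]|/allrelP lt_lsus].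
  by apply/allrelP => l u /lsy ly /usy; apply: le_lt_trans ly.
pose l := \big[Order.max/-oo]_(a <- ls) a.
pose u := \big[Order.min/+oo]_(b <- us) b.
have lt_l a : -oo < a -> {in ls, forall b, b < a} -> l < a.
  by move=> a_gtNy lt_lsa; rewrite /l big_seq; apply: bigmax_lt.
have lt_u a : a < +oo -> {in us, forall b, a < b} -> a < u.
  by move=> a_lty lt_aus; rewrite /u big_seq; apply: lt_bigmin.
have /mem_miditv : (Interval l u).1 < (Interval l u).2.
  apply: lt_u => [|b b_us]; last first.
    apply: lt_l => [|a a_ls]; last exact: lt_lsus.
    by rewrite bnd_simp (memPn us_gtNy).
  by apply: lt_l => // a a_ls; rewrite bnd_simp (memPn ls_lty).
rewrite itv_boundlr leBRight_ltBLeft => /andP[ly yu].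
exists (miditv (Interval l u)); apply/andP; split; apply/allP => a a_in.
  by apply: le_trans ly; rewrite /l le_bigmax_seq.
by apply: lt_le_trans yu _; rewrite /u ge_bigmin_seq.
Qed.

End IntervalBounds.

Lemma has_all_closed (X T : Type) (P : X -> pred T) (F : set X -> Prop) :
  F set0 -> F setT -> (forall A B, F A -> F B -> F (A `|` B)) ->
  (forall A B, F A -> F B -> F (A `&` B)) -> (forall p, F [set x | P x p]) ->
  forall ss, F [set x | has (all (P x)) ss].
Proof.
move=> F0 FT FU FI FP; have F_all s : F [set x | all (P x) s].
  elim: s => [|p s IHs].
    by rewrite (_ : mkset _ = setT) //; apply/predeqP.
  rewrite (_ : mkset _ = [set x | P x p] `&` [set x | all (P x) s]).
    exact: FI.
  by apply/predeqP => x; split=> /andP.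
elim=> [|s ss IHss].
  by rewrite (_ : mkset _ = set0) //; apply/predeqP.
rewrite (_ : mkset _ = [set x | all (P x) s] `|` [set x | has (all (P x)) ss]).
  exact: FU.
by apply/predeqP => x; split=> /orP.
Qed.

Section SemilinearSets.
Variable R : realFieldType.

Definition constraint (n : nat) : eqType := (bool * affine n)%type.

Definition csat n (x : 'I_n -> R) (p : constraint n) : bool :=
  0 < aff_eval x p.2 ?<= if p.1.

Section FourierMotzkin.
Variable n : nat.
Implicit Types (p q : constraint n.+1) (s : seq (constraint n.+1)).
Implicit Types (x : 'I_n -> R) (y : R).

Definition lower_constraints s := [seq p <- s | 0 < aff_slope p.2].
Definition upper_constraints s := [seq p <- s | aff_slope p.2 < 0].
Definition flat_constraints s := [seq p <- s | aff_slope p.2 == 0].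

Definition bound_value x p : R :=
  - aff_eval x (aff_tail p.2) / (aff_slope p.2)%:~R.
Definition lower_bound x p : itv_bound R := BSide p.1 (bound_value x p).
Definition upper_bound x p : itv_bound R := BSide (~~ p.1) (bound_value x p).

Lemma csat_lower x y p : 0 < aff_slope p.2 ->
  csat (cons_point y x) p = (lower_bound x p <= BLeft y)%O.
Proof.
rewrite -(ltr0z R) => slope_gt0; rewrite lteBSide /= lteif_pdivrMr //.
by rewrite -sub0r lteifBlDr -aff_eval_cons.
Qed.

Lemma csat_upper x y p : aff_slope p.2 < 0 ->
  csat (cons_point y x) p = (BLeft y < upper_bound x p)%O.
Proof.
rewrite -(ltrz0 R) => slope_lt0; rewrite lteBSide /= negbK lteif_ndivlMr //.
by rewrite -sub0r lteifBlDr -aff_eval_cons.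
Qed.

Lemma csat_flat x y p : aff_slope p.2 = 0 ->
  csat (cons_point y x) p = csat x (p.1, aff_tail p.2).
Proof. by move=> slope0; rewrite /csat aff_eval_cons slope0 mulr0 add0r. Qed.

Lemma all_csat_cons x y s :
  all (csat (cons_point y x)) s =
  [&& all (csat x) [seq (p.1, aff_tail p.2) | p <- flat_constraints s],
      all (<= BLeft y)%O (map (lower_bound x) (lower_constraints s)) &
      all (> BLeft y)%O (map (upper_bound x) (upper_constraints s))].
Proof.
rewrite !all_map !all_filter -!all_predI; apply: eq_all => p /=.
have [slope|slope|slope] := ltgtP (aff_slope p.2) 0; rewrite /= ?andbT.
- exact: csat_upper.
- by rewrite csat_lower.
- exact: csat_flat.
Qed.

(* [resolvent p q] says that the lower bound put by [p] on the first coordinate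
   is below the upper bound put by [q], with the denominators cleared. *)
Definition resolvent p q : constraint n :=
  (p.1 && q.1,
   aff_tail q.2 *~ aff_slope p.2 - aff_tail p.2 *~ aff_slope q.2).

Lemma csat_resolvent x p q : 0 < aff_slope p.2 -> aff_slope q.2 < 0 ->
  csat x (resolvent p q) = (lower_bound x p < upper_bound x q)%O.
Proof.
rewrite -(ltr0z R) -(ltrz0 R) => p_gt0 q_lt0; rewrite lteBSide negbK.
rewrite lteif_pdivrMr // mulrAC lteif_ndivlMr // !mulNr lteifN2 !mulrzr.
by rewrite /csat raddfB subr_lteif0r !raddfMz.
Qed.

Definition eliminate s : seq (constraint n) :=
  [seq (p.1, aff_tail p.2) | p <- flat_constraints s] ++
  [seq resolvent p q | p <- lower_constraints s, q <- upper_constraints s].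

Lemma all_csat_resolvents x s :
  all (csat x)
    [seq resolvent p q | p <- lower_constraints s, q <- upper_constraints s] =
  allrel <%O (map (lower_bound x) (lower_constraints s))
             (map (upper_bound x) (upper_constraints s)).
Proof.
rewrite allrel_mapl allrel_mapr.
rewrite -(eq_in_allrel (@csat_resolvent x) (filter_all _ _) (filter_all _ _)).
by rewrite allrel_allpairsE -map_allpairs all_map.
Qed.

Lemma eliminateP x s :
  all (csat x) (eliminate s) <-> exists y, all (csat (cons_point y x)) s.
Proof.
have /ex_point_between : +oo%O \notin map (lower_bound x) (lower_constraints s).
  by apply/mapP => -[].
move=> /(_ (map (upper_bound x) (upper_constraints s))) between.
rewrite all_cat all_csat_resolvents; split.
  move=> /andP[flat /between[|y bounds]]; first by apply/mapP => -[].
  by exists y; rewrite all_csat_cons flat.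
move=> [y]; rewrite all_csat_cons => /andP[-> bounds] /=.
by apply/between; [apply/mapP => -[]|exists y].
Qed.

End FourierMotzkin.

Definition semilinear n (A : set ('I_n -> R)) : Prop :=
  exists ss : seq (seq (constraint n)), A = [set x | has (all (csat x)) ss].

Section Closure.
Variable n : nat.
Implicit Types A B : set ('I_n -> R).

Lemma semilinear_csat (p : constraint n) : semilinear [set x | csat x p].
Proof. by exists [:: [:: p]]; apply/predeqP => x; rewrite /= andbT orbF. Qed.

Lemma semilinear_set0 : semilinear (set0 : set ('I_n -> R)).
Proof. by exists [::]; apply/predeqP. Qed.

Lemma semilinear_setT : semilinear [set: 'I_n -> R].
Proof. by exists [:: [::]]; apply/predeqP. Qed.

Lemma semilinear_setU A B :
  semilinear A -> semilinear B -> semilinear (A `|` B).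
Proof.
move=> [ss ->] [ts ->]; exists (ss ++ ts); apply/predeqP => x.
by rewrite /= has_cat; split=> /orP.
Qed.

Lemma semilinear_setI A B :
  semilinear A -> semilinear B -> semilinear (A `&` B).
Proof.
move=> [ss ->] [ts ->]; exists [seq s ++ t | s <- ss, t <- ts].
apply/predeqP => x; split=> /= [[/hasP[s s_in xs] /hasP[t t_in xt]]|].
  by apply/hasP; exists (s ++ t); [apply: allpairs_f|rewrite all_cat xs].
move=> /hasP[_ /allpairsP[[s t] [s_in t_in ->]]].
rewrite all_cat => /andP[xs xt].
by split; apply/hasP; [exists s|exists t].
Qed.

Lemma semilinear_setC A : semilinear A -> semilinear (~` A).
Proof.
move=> [ss ->]; move: ss.
apply: (has_all_closed (P := @csat n) (F := fun A => semilinear (~` A))).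
- by rewrite setC0; apply: semilinear_setT.
- by rewrite setCT; apply: semilinear_set0.
- by move=> *; rewrite setCU; apply: semilinear_setI.
- by move=> *; rewrite setCI; apply: semilinear_setU.
move=> [C f]; rewrite (_ : ~` _ = [set x | csat x (~~ C, - f)]).
  exact: semilinear_csat.
apply/funext => x; rewrite /csat /= raddfN lteif0Nr lteifNE.
by apply/propext; split=> /negP.
Qed.

Lemma semilinear_lt_affine f g :
  semilinear [set x : 'I_n -> R | aff_eval x f < aff_eval x g].
Proof.
rewrite (_ : mkset _ = [set x | csat x (false, g - f)]).
  exact: semilinear_csat.
by apply/predeqP => x; rewrite /csat /= raddfB subr_gt0.
Qed.

Lemma semilinear_unit_coord i : semilinear [set x : 'I_n -> R | 0 <= x i < 1].
Proof.
rewrite (_ : mkset _ =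
    ~` [set x | aff_eval x (aff_var i) < aff_eval x (aff_const n 0)] `&`
    [set x | aff_eval x (aff_var i) < aff_eval x (aff_const n 1)]).
  by apply: semilinear_setI;
    [apply: semilinear_setC|]; exact: semilinear_lt_affine.
apply/predeqP => x; rewrite /= !aff_eval_const aff_eval_var.
by rewrite leNgt -(rwP andP) -(rwP negP).
Qed.

End Closure.

Lemma semilinear_exists n (A : set ('I_n.+1 -> R)) :
  semilinear A -> semilinear [set x | exists y, A (cons_point y x)].
Proof.
move=> [ss ->]; exists (map (@eliminate n) ss); apply/predeqP => x.
rewrite /= has_map.
split=> [[y /hasP[s s_in ys]]|/hasP[s s_in /eliminateP[y ys]]].
  by apply/hasP; exists s => //; apply/eliminateP; exists y.
by exists y; apply/hasP; exists s.
Qed.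

End SemilinearSets.

Section FractionalPart.
Variable R : archiRealDomainType.
Implicit Types (z b : R) (m : int).

Definition frac z : R := z - (Num.floor z)%:~R.

Lemma frac_itv z : 0 <= frac z < 1.
Proof. by have := floor_itv z; rewrite intrD /frac; lra. Qed.

Lemma floorD_carry z b : 0 <= b < 1 ->
  Num.floor (z + b) = Num.floor z + (frac (z + b) < b)%R%:Z.
Proof.
have := frac_itv z; rewrite /frac => z_itv b_itv.
have [no_carry|carry] := ltP (z - (Num.floor z)%:~R + b) 1.
  have -> : Num.floor (z + b) = Num.floor z.
    by apply/eqP; rewrite floor_eq intrD; lra.
  by rewrite (_ : (_ < b) = false) ?addr0 //; apply/negbTE; rewrite -leNgt; lra.
have -> : Num.floor (z + b) = Num.floor z + 1.
  by apply/eqP; rewrite floor_eq !intrD; lra.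
by rewrite intrD (_ : (_ < b) = true) //; lra.
Qed.

Lemma ler_intD_carry m z b : 0 <= b < 1 ->
  (m%:~R <= z + b) =
  (m%:~R <= z) || ((m - 1)%:~R <= z) && (frac (z + b) < b).
Proof.
move=> /floorD_carry floorE; rewrite -!floor_ge_int floorE lerBlDr.
case: (_ < _); rewrite ?andbT ?andbF ?orbF ?addr0 //.
by rewrite orb_idl // => /le_trans-> //; rewrite lerDl.
Qed.

Lemma ltr_int_frac m z :
  (m%:~R < z) = ((m + 1)%:~R <= z) || (m%:~R <= z) && (0 < frac z).
Proof.
rewrite -!floor_ge_int lezD1 /frac subr_gt0.
have [lt_m|lt_floor|->] := ltgtP m (Num.floor z) => //=.
- by rewrite (lt_le_trans _ (floor_le z)) ?ltr_int.
- by apply/negbTE; rewrite -leNgt ltW // -floor_lt_int.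
Qed.

End FractionalPart.

Section ProjectionModulo1.
Variable R : realType.
Implicit Types (z w : R) (a : D R).

Definition mod1 z : D R := exist _ (frac z) (frac_itv z).

Lemma mod1_eq z (k : int) a : z = sval a + k%:~R -> mod1 z = a.
Proof.
move=> z_eq; apply: val_inj; rewrite /= /frac.
have -> : Num.floor z = k; last by rewrite z_eq addrK.
by apply/eqP; rewrite floor_eq z_eq intrD; have := svalP a; lra.
Qed.

Lemma mod1_sval a : mod1 (sval a) = a.
Proof. by apply: (@mod1_eq _ 0); rewrite addr0. Qed.

Lemma mod1_int (c : int) : mod1 c%:~R = s_zero (D R).
Proof. by apply: (@mod1_eq _ c); rewrite add0r. Qed.

Lemma mod1N z : mod1 (- z) = s_opp (mod1 z).
Proof.
have [frac0|frac_neq0] := eqVneq (frac z) 0.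
  apply: (@mod1_eq _ (- Num.floor z)); rewrite /= /opp1 frac0 eqxx mulrNz.
  by move: frac0; rewrite /frac; lra.
apply: (@mod1_eq _ (- Num.floor z - 1)).
by rewrite /= /opp1 (negPf frac_neq0) intrD !mulrNz /frac; lra.
Qed.

Lemma mod1D z w : mod1 (z + w) = s_add (mod1 z) (mod1 w).
Proof.
have [no_carry|carry] := ltP (frac z + frac w) 1.
  apply: (@mod1_eq _ (Num.floor z + Num.floor w)).
  by rewrite /= /add1 no_carry intrD /frac; lra.
apply: (@mod1_eq _ (Num.floor z + Num.floor w + 1)).
by rewrite /= /add1 ltNge carry /= !intrD /frac; lra.
Qed.

End ProjectionModulo1.

Section Definability.
Variable R : realType.

Definition vals n (v : 'I_n -> D R) (i : 'I_n) : R := sval (v i).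

Lemma vals_itv n (v : 'I_n -> D R) i : 0 <= vals v i < 1.
Proof. exact: (svalP (v i)). Qed.

Lemma vals_extend n (a : D R) (v : 'I_n -> D R) :
  vals (extend a v) = cons_point (sval a) (vals v).
Proof.
by apply/funext => i; rewrite /vals /extend /cons_point; case: unlift.
Qed.

Section FixedArity.
Variable n : nat.
Implicit Types (v : 'I_n -> D R) (X Y : set ('I_n -> D R)) (f : affine n).
Implicit Types (t u : term n).

Fixpoint affine_of_term t : affine n :=
  match t with
  | TVar i => aff_var i
  | TZero => 0
  | TOpp t1 => - affine_of_term t1
  | TAdd t1 t2 => affine_of_term t1 + affine_of_term t2
  end.

Lemma eval_mod1 t v : eval v t = mod1 (aff_eval (vals v) (affine_of_term t)).
Proof.
elim: t => [i||t IHt|t IHt u IHu].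
- by rewrite aff_eval_var mod1_sval.
- by rewrite raddf0 (mod1_int _ 0).
- by rewrite raddfN mod1N -IHt.
- by rewrite raddfD mod1D -IHt -IHu.
Qed.

Lemma ex_term_mod1 f :
  exists t, forall v, eval v t = mod1 (aff_eval (vals v) f).
Proof.
elim/affine_ind: f => [c|f i [t IHt]|f [t IHt]].
- by exists TZero => v; rewrite aff_eval_const mod1_int.
- by exists (TAdd t (TVar i)) => v; rewrite aff_evalDvar mod1D -IHt mod1_sval.
- by exists (TOpp t) => v; rewrite raddfN mod1N -IHt.
Qed.

Lemma floor_aff_eval_finite f :
  exists s : seq int, forall v, Num.floor (aff_eval (vals v) f) \in s.
Proof.
elim/affine_ind: f => [c|f i [s IHs]|f [s IHs]].
- by exists [:: c] => v; rewrite aff_eval_const intrKfloor mem_head.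
- exists [seq k + b%:Z | k <- s, b <- [:: 0; 1]%N] => v.
  rewrite aff_evalDvar floorD_carry ?vals_itv //.
  by apply: (allpairs_f (fun k (b : nat) => k + b%:Z)) => //; case: (_ < _).
- exists [seq - (k + b%:Z) | k <- s, b <- [:: 0; 1]%N] => v.
  rewrite raddfN floorNceil opprK ceil_floor.
  apply: (allpairs_f (fun k (b : nat) => - (k + b%:Z))); first exact: IHs.
  by case: (~~ _).
Qed.

Definition semilinear_trace X : Prop :=
  exists2 A, semilinear A & X = @vals n @^-1` A.

Lemma semilinear_traceC X : semilinear_trace X -> semilinear_trace (~` X).
Proof.
move=> [A A_sl ->]; exists (~` A); first exact: semilinear_setC.
by rewrite preimage_setC.
Qed.

Lemma semilinear_traceI X Y :
  semilinear_trace X -> semilinear_trace Y -> semilinear_trace (X `&` Y).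
Proof.
move=> [A A_sl ->] [B B_sl ->]; exists (A `&` B); first exact: semilinear_setI.
by rewrite preimage_setI.
Qed.

Lemma semilinear_traceU X Y :
  semilinear_trace X -> semilinear_trace Y -> semilinear_trace (X `|` Y).
Proof.
move=> [A A_sl ->] [B B_sl ->]; exists (A `|` B); first exact: semilinear_setU.
by rewrite preimage_setU.
Qed.

Lemma semilinear_trace_lt_affine f g :
  semilinear_trace [set v | aff_eval (vals v) f < aff_eval (vals v) g].
Proof.
exists [set x | aff_eval x f < aff_eval x g] => //.
exact: semilinear_lt_affine.
Qed.

Lemma semilinear_trace_floor f (k : int) :
  semilinear_trace [set v | Num.floor (aff_eval (vals v) f) = k].
Proof.
rewrite (_ : mkset _ =
    ~` [set v | aff_eval (vals v) f < aff_eval (vals v) (aff_const n k)] `&`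
    [set v | aff_eval (vals v) f < aff_eval (vals v) (aff_const n (k + 1))]).
  by apply: semilinear_traceI;
    [apply: semilinear_traceC|]; exact: semilinear_trace_lt_affine.
apply/predeqP => v; rewrite /= !aff_eval_const.
by rewrite (rwP eqP) floor_eq leNgt -(rwP andP) -(rwP negP).
Qed.

Lemma semilinear_trace_floor_cases f X :
  (forall k : int,
     semilinear_trace ([set v | Num.floor (aff_eval (vals v) f) = k] `&` X)) ->
  semilinear_trace X.
Proof.
move=> X_fibers; have [s floor_in_s] := floor_aff_eval_finite f.
rewrite (_ : X = \bigcup_(k in [set` s])
    ([set v | Num.floor (aff_eval (vals v) f) = k] `&` X)).
  rewrite bigcup_seq; elim/big_ind: _ => //.
    by exists set0; [exact: semilinear_set0|rewrite preimage_set0].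
  exact: semilinear_traceU.
apply/predeqP => v; split=> [Xv|[k _ []//]].
by exists (Num.floor (aff_eval (vals v) f)) => //; exact: floor_in_s.
Qed.

Lemma semilinear_trace_lt t u :
  semilinear_trace [set v | s_lt (eval v t) (eval v u)].
Proof.
set f := affine_of_term t; set g := affine_of_term u.
apply: (semilinear_trace_floor_cases (f := f)) => k.
apply: (semilinear_trace_floor_cases (f := g)) => l.
rewrite (_ : _ `&` (_ `&` _) =
    [set v | Num.floor (aff_eval (vals v) f) = k] `&`
    ([set v | Num.floor (aff_eval (vals v) g) = l] `&`
    [set v | aff_eval (vals v) (f - aff_const n k) <
             aff_eval (vals v) (g - aff_const n l)])).
  apply: semilinear_traceI; first exact: semilinear_trace_floor.
  apply: semilinear_traceI; first exact: semilinear_trace_floor.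
  exact: semilinear_trace_lt_affine.
apply/predeqP => v.
rewrite /= /Dlt !eval_mod1 /= /frac !raddfB /= !aff_eval_const.
by split=> -[-> [->]].
Qed.

End FixedArity.

Lemma semilinear_trace_exists n (X : set ('I_n.+1 -> D R)) :
  semilinear_trace X ->
  semilinear_trace [set v | exists a : D R, X (extend a v)].
Proof.
move=> [A A_sl ->].
pose unit_slab := [set x : 'I_n.+1 -> R | 0 <= x ord0 < 1].
exists [set x | exists y, (unit_slab `&` A) (cons_point y x)].
  exact/semilinear_exists/semilinear_setI/A_sl/semilinear_unit_coord.
have unit_slabE y (x : 'I_n -> R) : unit_slab (cons_point y x) <-> 0 <= y < 1.
  by rewrite /unit_slab /cons_point /= unlift_none.
apply/predeqP => v; split=> [[a Aa]|[y [/unit_slabE y01 Ay]]].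
  exists (sval a); split; first by apply/unit_slabE; exact: (svalP a).
  by rewrite -vals_extend.
by exists (exist _ y y01); rewrite /preimage /= vals_extend.
Qed.

Lemma semilinear_trace_satisfies n (phi : formula n) :
  semilinear_trace [set v : 'I_n -> D R | satisfies phi v].
Proof.
elim: phi => {n} [n t u|n t u|n p IHp|n p IHp q IHq|n p IHp q IHq|n p IHp q IHq
  |n p IHp|n p IHp].
- rewrite (_ : mkset _ = ~` [set v | s_lt (eval v t) (eval v u)] `&`
                         ~` [set v | s_lt (eval v u) (eval v t)]).
    by apply: semilinear_traceI; apply: semilinear_traceC;
      exact: semilinear_trace_lt.
  apply/predeqP => v; split=> /= [->|[/negP tu /negP ut]].
    by split; rewrite /Dlt ltxx.
  by apply/val_inj/le_anti; rewrite !leNgt tu ut.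
- exact: semilinear_trace_lt.
- exact: semilinear_traceC.
- exact: semilinear_traceI.
- exact: semilinear_traceU.
- rewrite (_ : mkset _ =
    ~` [set v | satisfies p v] `|` [set v | satisfies q v]).
    by apply: semilinear_traceU => //; exact: semilinear_traceC.
  by apply/predeqP => v; rewrite /= implyE.
- rewrite (_ : mkset _ =
    ~` [set v | exists a : D R, (~` [set w | satisfies p w]) (extend a v)]).
    by apply/semilinear_traceC/semilinear_trace_exists/semilinear_traceC.
  by apply/predeqP => v; rewrite /= existsNE notK.
- exact: semilinear_trace_exists.
Qed.

Section QuantifierFreeSets.
Variable n : nat.
Implicit Types (v : 'I_n -> D R) (X Y : set ('I_n -> D R)) (f : affine n).

Definition qf_definable X : Prop :=
  exists2 psi : formula n, quantifier_free psi & X = [set v | satisfies psi v].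

Lemma qf_definable_lt t u : qf_definable [set v | s_lt (eval v t) (eval v u)].
Proof. by exists (FLt t u). Qed.

Lemma qf_definableT : qf_definable [set: 'I_n -> D R].
Proof. by exists (FEq TZero TZero) => //; apply/predeqP. Qed.

Lemma qf_definableC X : qf_definable X -> qf_definable (~` X).
Proof. by move=> [p p_qf ->]; exists (FNot p). Qed.

Lemma qf_definable0 : qf_definable (set0 : set ('I_n -> D R)).
Proof. by rewrite -setCT; apply/qf_definableC/qf_definableT. Qed.

Lemma qf_definableI X Y :
  qf_definable X -> qf_definable Y -> qf_definable (X `&` Y).
Proof. by move=> [p p_qf ->] [q q_qf ->]; exists (FAnd p q). Qed.

Lemma qf_definableU X Y :
  qf_definable X -> qf_definable Y -> qf_definable (X `|` Y).
Proof. by move=> [p p_qf ->] [q q_qf ->]; exists (FOr p q). Qed.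

Lemma qf_definable_gt_of_ge f :
  (forall m : int, qf_definable [set v | m%:~R <= aff_eval (vals v) f]) ->
  forall m : int, qf_definable [set v | m%:~R < aff_eval (vals v) f].
Proof.
move=> f_le m; have [t tE] := ex_term_mod1 f.
rewrite (_ : mkset _ = [set v | (m + 1)%:~R <= aff_eval (vals v) f] `|`
    ([set v | m%:~R <= aff_eval (vals v) f] `&`
     [set v | s_lt (eval v TZero) (eval v t)])).
  apply: qf_definableU => //; apply: qf_definableI => //.
  exact: qf_definable_lt.
apply/predeqP => v; rewrite /= tE ltr_int_frac.
by rewrite -(rwP orP) -(rwP andP).
Qed.

Lemma qf_definable_ge_affine f (m : int) :
  qf_definable [set v | m%:~R <= aff_eval (vals v) f].
Proof.
elim/affine_ind: f m => [c|f i IHf|f IHf] m.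
- rewrite (_ : mkset _ = if m <= c then setT else set0).
    by case: ifP => _; [exact: qf_definableT|exact: qf_definable0].
  by apply/predeqP => v; rewrite /= aff_eval_const ler_int; case: (_ <= _).
- have [t tE] := ex_term_mod1 (f + aff_var i).
  rewrite (_ : mkset _ = [set v | m%:~R <= aff_eval (vals v) f] `|`
      ([set v | (m - 1)%:~R <= aff_eval (vals v) f] `&`
       [set v | s_lt (eval v t) (eval v (TVar i))])).
    apply: qf_definableU => //; apply: qf_definableI => //.
    exact: qf_definable_lt.
  apply/predeqP => v; rewrite /= tE aff_evalDvar ler_intD_carry ?vals_itv //.
  by rewrite -(rwP orP) -(rwP andP).
- rewrite (_ : mkset _ = ~` [set v | (- m)%:~R < aff_eval (vals v) f]).
    exact/qf_definableC/qf_definable_gt_of_ge.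
  by apply/predeqP => v; rewrite /= raddfN mulrNz ltrNl (rwP negP) -leNgt.
Qed.

Lemma qf_definable_csat (p : constraint n) :
  qf_definable [set v | csat (vals v) p].
Proof.
case: p => -[] f; first exact: (qf_definable_ge_affine f 0).
exact: (qf_definable_gt_of_ge (qf_definable_ge_affine f) 0).
Qed.

Lemma qf_definable_semilinear_trace X : semilinear_trace X -> qf_definable X.
Proof.
move=> [_ [ss ->] ->].
apply: (has_all_closed (P := fun v => csat (vals v)) (F := qf_definable)).
- exact: qf_definable0.
- exact: qf_definableT.
- exact: qf_definableU.
- exact: qf_definableI.
- exact: qf_definable_csat.
Qed.

End QuantifierFreeSets.
End Definability.

Lemma holds_universal_closure (M : L_structure) n (phi : formula n) :
  (forall v : 'I_n -> M, satisfies phi v) -> holds M (universal_closure phi).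
Proof. by elim: n phi => [//|n IHn] phi sat; apply: IHn => v a; apply: sat. Qed.

Theorem theorem5p2 (R : realType) : admits_QE (complete_theory (D R)).
Proof.
move=> n phi.
have [psi psi_qf psiE] :=
  qf_definable_semilinear_trace (semilinear_trace_satisfies R phi).
exists psi; split=> // M; apply; apply: holds_universal_closure => v.
by have /predeqP/(_ v) := psiE.
Qed.
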